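(* Let $\mathcal{A}$ and $\mathcal{B}$ be abelian categories, and let $(L,R)$ be an adjoint pair of covariant functors $L:\mathcal{A}\to \mathcal{B}$ and $R:\mathcal{B}\to \mathcal{A}$ ($L$ left adjoint to $R$). (1) Assume that $L$ is exact and $R$ is fully faithful. Let $M$ and $N$ be objects of $\mathcal{B}$. Then $N$ is $M$-CS-Rickart in $\mathcal{B}$ if and only if $R(N)$ is $R(M)$-CS-Rickart in $\mathcal{A}$. (2) Assume that $R$ is exact and $L$ is fully faithful. Let $M$ and $N$ be objects of $\mathcal{A}$. Then $N$ is dual $M$-CS-Rickart in $\mathcal{A}$ if and only if $L(N)$ is dual $L(M)$-CS-Rickart in $\mathcal{B}$.
   Context: In an abelian category: a morphism $s:A\to B$ is a section (resp. $r:A\to B$ is a retraction) if there is $s':B\to A$ with $s's=1_A$ (resp. $r':B\to A$ with $rr'=1_B$). A monomorphism $f:X\to Y$ is essential if for every morphism $h:Y\to P$ such that $hf$ is a monomorphism, $h$ is a monomorphism. An epimorphism $f:X\to Y$ is superfluous if for every morphism $h:P\to X$ such that $fh$ is an epimorphism, $h$ is an epimorphism. For objects $M,N$ of an abelian category: $N$ is $M$-CS-Rickart if for every morphism $f:M\to N$ there are an essential monomorphism $e:\mathrm{Ker}(f)\to L$ and a section $s:L\to M$ with $\ker(f)=se$. $N$ is dual $M$-CS-Rickart if for every morphism $f:M\to N$ there are a retraction $r:N\to P$ and a superfluous epimorphism $t:P\to \mathrm{Coker}(f)$ with $\mathrm{coker}(f)=tr$. *)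

(* Defs.v *)
Set Implicit Arguments.
Unset Strict Implicit.
Unset Printing Implicit Defensive.

Declare Scope cat_scope.
Delimit Scope cat_scope with cat.
Local Open Scope cat_scope.

Record category := Category {
  obj :> Type;
  hom : obj -> obj -> Type;
  idm : forall A : obj, hom A A;
  comp : forall A B C : obj, hom B C -> hom A B -> hom A C;
  comp_idl : forall (A B : obj) (f : hom A B), comp (idm B) f = f;
  comp_idr : forall (A B : obj) (f : hom A B), comp f (idm A) = f;
  comp_assoc : forall (A B C D : obj) (h : hom C D) (g : hom B C) (f : hom A B),
    comp h (comp g f) = comp (comp h g) f
}.

Arguments hom {c} A B.
Arguments idm {c} A.
Arguments comp {c A B C} g f.

Notation "A ~> B" := (hom A B) (at level 60, no associativity) : cat_scope.
(* Applicative order: [g ∘ f] is [f] followed by [g]. *)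
Notation "g ∘ f" := (comp g f) (at level 40, left associativity) : cat_scope.

Section Morphisms.
Variable C : category.

Definition mono (A B : C) (f : A ~> B) : Prop :=
  forall (X : C) (g h : X ~> A), f ∘ g = f ∘ h -> g = h.

Definition epi (A B : C) (f : A ~> B) : Prop :=
  forall (Y : C) (g h : B ~> Y), g ∘ f = h ∘ f -> g = h.

Definition is_section (A B : C) (s : A ~> B) : Prop :=
  exists s' : B ~> A, s' ∘ s = idm A.

Definition is_retraction (A B : C) (r : A ~> B) : Prop :=
  exists r' : B ~> A, r ∘ r' = idm B.

Definition essential_mono (X Y : C) (f : X ~> Y) : Prop :=
  mono f /\ forall (P : C) (h : Y ~> P), mono (h ∘ f) -> mono h.

Definition superfluous_epi (X Y : C) (f : X ~> Y) : Prop :=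
  epi f /\ forall (P : C) (h : P ~> X), epi (f ∘ h) -> epi h.

Definition zero_object (Z : C) : Prop :=
  forall A : C, (exists! i : Z ~> A, True) /\ (exists! p : A ~> Z, True).

End Morphisms.

(* The abelian group structure on hom-sets is given by plain fields rather than
   by MathComp's [zmodType], which would also require a choice structure on
   every hom-set. *)
Record preadditive := Preadditive {
  pre_cat :> category;
  zerom : forall A B : pre_cat, A ~> B;
  oppm : forall A B : pre_cat, A ~> B -> A ~> B;
  addm : forall A B : pre_cat, A ~> B -> A ~> B -> A ~> B;
  addmA : forall (A B : pre_cat) (f g h : A ~> B),
    addm f (addm g h) = addm (addm f g) h;
  addmC : forall (A B : pre_cat) (f g : A ~> B), addm f g = addm g f;
  add0m : forall (A B : pre_cat) (f : A ~> B), addm (zerom A B) f = f;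
  addNm : forall (A B : pre_cat) (f : A ~> B), addm (oppm f) f = zerom A B;
  comp_addl : forall (A B C : pre_cat) (g h : B ~> C) (f : A ~> B),
    addm g h ∘ f = addm (g ∘ f) (h ∘ f);
  comp_addr : forall (A B C : pre_cat) (f : B ~> C) (g h : A ~> B),
    f ∘ addm g h = addm (f ∘ g) (f ∘ h)
}.

Arguments zerom {p} A B.
Arguments oppm {p A B} f.
Arguments addm {p A B} f g.

Section Kernels.
Variable C : preadditive.

Definition is_kernel (A B K : C) (f : A ~> B) (k : K ~> A) : Prop :=
  f ∘ k = zerom K B /\
  forall (X : C) (x : X ~> A), f ∘ x = zerom X B ->
    exists! u : X ~> K, k ∘ u = x.

Definition is_cokernel (A B Q : C) (f : A ~> B) (q : B ~> Q) : Prop :=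
  q ∘ f = zerom A Q /\
  forall (Y : C) (y : B ~> Y), y ∘ f = zerom A Y ->
    exists! u : Q ~> Y, u ∘ q = y.

Definition is_biproduct (A B S : C)
    (i1 : A ~> S) (i2 : B ~> S) (p1 : S ~> A) (p2 : S ~> B) : Prop :=
  p1 ∘ i1 = idm A /\ p2 ∘ i2 = idm B /\
  p2 ∘ i1 = zerom A B /\ p1 ∘ i2 = zerom B A /\
  addm (i1 ∘ p1) (i2 ∘ p2) = idm S.

(* 0 -> A -> B -> D -> 0 is exact. *)
Definition short_exact (A B D : C) (f : A ~> B) (g : B ~> D) : Prop :=
  is_kernel g f /\ is_cokernel f g.

End Kernels.

Record abelian := Abelian {
  ab_pre :> preadditive;
  has_zero : exists Z : ab_pre, zero_object Z;
  has_biproducts : forall A B : ab_pre,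
    exists (S : ab_pre) (i1 : A ~> S) (i2 : B ~> S) (p1 : S ~> A) (p2 : S ~> B),
      is_biproduct i1 i2 p1 p2;
  has_kernels : forall (A B : ab_pre) (f : A ~> B),
    exists (K : ab_pre) (k : K ~> A), is_kernel f k;
  has_cokernels : forall (A B : ab_pre) (f : A ~> B),
    exists (Q : ab_pre) (q : B ~> Q), is_cokernel f q;
  mono_normal : forall (A B : ab_pre) (f : A ~> B), mono f ->
    exists (D : ab_pre) (g : B ~> D), is_kernel g f;
  epi_normal : forall (A B : ab_pre) (f : A ~> B), epi f ->
    exists (D : ab_pre) (g : D ~> A), is_cokernel g f
}.

Record functor (C D : category) := Functor {
  fobj :> C -> D;
  fmap : forall X Y : C, X ~> Y -> fobj X ~> fobj Y;
  fmap_id : forall X : C, fmap (idm X) = idm (fobj X);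
  fmap_comp : forall (X Y Z : C) (g : Y ~> Z) (f : X ~> Y),
    fmap (g ∘ f) = fmap g ∘ fmap f
}.

Arguments fmap {C D} F {X Y} f : rename.

Definition full (C D : category) (F : functor C D) : Prop :=
  forall (X Y : C) (g : F X ~> F Y), exists f : X ~> Y, fmap F f = g.

Definition faithful (C D : category) (F : functor C D) : Prop :=
  forall (X Y : C) (f g : X ~> Y), fmap F f = fmap F g -> f = g.

Definition fully_faithful (C D : category) (F : functor C D) : Prop :=
  full F /\ faithful F.

(* Additivity need not be required separately: it follows both from preservation
   of (split) short exact sequences and from being part of an adjunction. *)
Definition exact_functor (C D : abelian) (F : functor C D) : Prop :=
  forall (X Y Z : C) (f : X ~> Y) (g : Y ~> Z),
    short_exact f g -> short_exact (fmap F f) (fmap F g).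

(* [L] is left adjoint to [R]. *)
Record adjunction (C D : category) (L : functor C D) (R : functor D C) :=
  Adjunction {
  adj_to : forall (X : C) (Y : D), L X ~> Y -> X ~> R Y;
  adj_from : forall (X : C) (Y : D), X ~> R Y -> L X ~> Y;
  adj_toK : forall (X : C) (Y : D) (f : L X ~> Y), adj_from (adj_to f) = f;
  adj_fromK : forall (X : C) (Y : D) (g : X ~> R Y), adj_to (adj_from g) = g;
  adj_natl : forall (X X' : C) (Y : D) (f : L X ~> Y) (x : X' ~> X),
    adj_to (f ∘ fmap L x) = adj_to f ∘ x;
  adj_natr : forall (X : C) (Y Y' : D) (f : L X ~> Y) (y : Y ~> Y'),
    adj_to (y ∘ f) = fmap R y ∘ adj_to f
}.

(* [cs_rickart M N] reads "N is M-CS-Rickart". Kernels are only determined up to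
   isomorphism, so the condition is imposed on every kernel of [f]; the
   condition does not depend on the choice. Dually for cokernels. *)
Definition cs_rickart (C : abelian) (M N : C) : Prop :=
  forall (f : M ~> N) (K : C) (k : K ~> M), is_kernel f k ->
    exists (L : C) (e : K ~> L) (s : L ~> M),
      essential_mono e /\ is_section s /\ k = s ∘ e.

Definition dual_cs_rickart (C : abelian) (M N : C) : Prop :=
  forall (f : M ~> N) (Q : C) (q : N ~> Q), is_cokernel f q ->
    exists (P : C) (r : N ~> P) (t : P ~> Q),
      is_retraction r /\ superfluous_epi t /\ q = t ∘ r.

(* Main.v *)
(** Part (1). A right adjoint preserves kernels and, when [R] is fully faithful,
    the counit [L R -> 1] is an isomorphism.  If moreover [L] preserves
    monomorphisms, then [R] preserves essential monomorphisms, and so does [L]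
    for those with source in the image of [R]; kernel factorisations can thus be
    carried back and forth.  Part (2) is part (1) applied to the adjoint pair
    [(R^op, L^op)] between the opposite categories. *)
From Corelib Require Import ssreflect.
Require Import Defs.

Set Implicit Arguments.
Unset Strict Implicit.
Unset Printing Implicit Defensive.

Local Open Scope cat_scope.

(** * Monomorphisms, sections and essential monomorphisms *)

Section Category.
Variable C : category.

Lemma mono_comp (X Y Z : C) (g : Y ~> Z) (f : X ~> Y) :
  mono g -> mono f -> mono (g ∘ f).
Proof.
move=> mono_g mono_f T x y; rewrite -!comp_assoc => eq_xy.
exact/mono_f/mono_g.
Qed.

Lemma mono_of_comp (X Y Z : C) (g : Y ~> Z) (f : X ~> Y) :
  mono (g ∘ f) -> mono f.
Proof. by move=> mono_gf T x y eq_xy; apply: mono_gf; rewrite -!comp_assoc eq_xy. Qed.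

Lemma section_mono (X Y : C) (s : X ~> Y) : is_section s -> mono s.
Proof.
move=> [s' s'K]; apply: (@mono_of_comp _ _ _ s').
by rewrite s'K => T x y; rewrite !comp_idl.
Qed.

Lemma section_comp (X Y Z : C) (g : Y ~> Z) (f : X ~> Y) :
  is_section g -> is_section f -> is_section (g ∘ f).
Proof.
move=> [g' g'K] [f' f'K]; exists (f' ∘ g').
by rewrite -comp_assoc [g' ∘ _]comp_assoc g'K comp_idl.
Qed.

(** Used to change the chosen kernel object. Since [h ∘ e = (h ∘ e ∘ u) ∘ v] with [v] split mono,
    the test for [e ∘ u] reduces to that for [e]. *)
Lemma essential_mono_precomp_iso (X Y Z : C) (e : Y ~> Z) (u : X ~> Y)
    (v : Y ~> X) :
  v ∘ u = idm X -> u ∘ v = idm Y -> essential_mono e -> essential_mono (e ∘ u).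
Proof.
move=> vu uv [mono_e ess_e]; split.
  by apply: mono_comp => //; apply: section_mono; exists v.
move=> P h mono_heu; apply: ess_e.
rewrite -[h ∘ e]comp_idr -uv comp_assoc -[h ∘ e ∘ u]comp_assoc.
by apply: mono_comp => //; apply: section_mono; exists u.
Qed.

End Category.

Lemma fmap_section (C D : category) (F : functor C D) (X Y : C) (s : X ~> Y) :
  is_section s -> is_section (fmap F s).
Proof. by move=> [s' s'K]; exists (fmap F s'); rewrite -fmap_comp s'K fmap_id. Qed.

(** * Zero morphisms and kernels *)

Section Preadditive.
Variable C : preadditive.

Lemma addm_idem_zero (X Y : C) (f : X ~> Y) : addm f f = f -> f = zerom X Y.
Proof. by move=> ff; rewrite -(addNm f) -{3}ff addmA addNm add0m. Qed.

Lemma comp0m (X Y Z : C) (f : X ~> Y) : zerom Y Z ∘ f = zerom X Z.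
Proof. by apply: addm_idem_zero; rewrite -comp_addl add0m. Qed.

Lemma compm0 (X Y Z : C) (f : Y ~> Z) : f ∘ zerom X Y = zerom X Z.
Proof. by apply: addm_idem_zero; rewrite -comp_addr add0m. Qed.

Lemma kernel_mono (X Y K : C) (f : X ~> Y) (k : K ~> X) : is_kernel f k -> mono k.
Proof.
move=> [fk0 ker_univ] T x y eq_xy.
have [|u [_ u_unique]] := ker_univ T (k ∘ x).
  by rewrite comp_assoc fk0 comp0m.
by rewrite -(u_unique x (eq_refl _)); apply: u_unique.
Qed.

Lemma kernel_unique (X Y K K' : C) (f : X ~> Y) (k : K ~> X) (k' : K' ~> X) :
  is_kernel f k -> is_kernel f k' ->
  exists (u : K' ~> K) (v : K ~> K'),
    v ∘ u = idm K' /\ u ∘ v = idm K /\ k ∘ u = k'.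
Proof.
move=> ker_k ker_k'.
have mono_k := kernel_mono ker_k; have mono_k' := kernel_mono ker_k'.
have [u [ku _]] := proj2 ker_k _ _ (proj1 ker_k').
have [v [k'v _]] := proj2 ker_k' _ _ (proj1 ker_k).
exists u, v; split; [|split] => //.
  by apply: mono_k'; rewrite comp_assoc k'v ku comp_idr.
by apply: mono_k; rewrite comp_assoc ku k'v comp_idr.
Qed.

End Preadditive.

(** A normal mono is the kernel of its own cokernel: the map [g] of which [f] is a kernel factors
    through [q], so whatever [q] kills, [g] kills. Exactness of a functor speaks of short exact
    sequences only, hence this completion. *)
Lemma mono_short_exact (C : abelian) (X Y : C) (f : X ~> Y) :
  mono f -> exists (Q : C) (q : Y ~> Q), short_exact f q.
Proof.
move=> mono_f; have [Q [q coker_q]] := has_cokernels f.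
exists Q, q; split=> //; split; first exact: (proj1 coker_q).
have [D [g [gf0 ker_univ]]] := mono_normal mono_f.
have [w [wq _]] := proj2 coker_q D g gf0.
move=> T x qx0; apply: ker_univ.
by rewrite -wq -comp_assoc qx0 compm0.
Qed.

Lemma exact_functor_mono (C D : abelian) (F : functor C D) (X Y : C) (f : X ~> Y) :
  exact_functor F -> mono f -> mono (fmap F f).
Proof.
move=> exF mono_f; have [Q [q ex_fq]] := mono_short_exact mono_f.
exact: kernel_mono (proj1 (exF _ _ _ _ _ ex_fq)).
Qed.

(** * Adjunctions, the counit and transport of essential monomorphisms *)

Section Adjunction.
Variables (C D : category) (L : functor C D) (R : functor D C).
Variable adj : adjunction L R.

Lemma adj_to_inj (X : C) (Y : D) (f g : L X ~> Y) :
  adj_to adj f = adj_to adj g -> f = g.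
Proof. by move=> eq_fg; rewrite -(adj_toK adj f) eq_fg adj_toK. Qed.

Lemma adj_from_inj (X : C) (Y : D) (f g : X ~> R Y) :
  adj_from adj f = adj_from adj g -> f = g.
Proof. by move=> eq_fg; rewrite -(adj_fromK adj f) eq_fg adj_fromK. Qed.

Lemma adj_from_natl (X X' : C) (Y : D) (g : X ~> R Y) (x : X' ~> X) :
  adj_from adj (g ∘ x) = adj_from adj g ∘ fmap L x.
Proof. by apply: adj_to_inj; rewrite adj_natl !adj_fromK. Qed.

Lemma adj_from_natr (X : C) (Y Y' : D) (g : X ~> R Y) (y : Y ~> Y') :
  adj_from adj (fmap R y ∘ g) = y ∘ adj_from adj g.
Proof. by apply: adj_to_inj; rewrite adj_natr !adj_fromK. Qed.

Definition counit (Y : D) : L (R Y) ~> Y := adj_from adj (idm (R Y)).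

Lemma adj_fromE (X : C) (Y : D) (g : X ~> R Y) :
  adj_from adj g = counit Y ∘ fmap L g.
Proof. by rewrite -adj_from_natl comp_idl. Qed.

Lemma counit_natural (Y Y' : D) (y : Y ~> Y') :
  counit Y' ∘ fmap L (fmap R y) = y ∘ counit Y.
Proof. by rewrite -adj_fromE -adj_from_natr comp_idr. Qed.

Lemma right_adjoint_mono (X Y : D) (f : X ~> Y) : mono f -> mono (fmap R f).
Proof.
move=> mono_f T x y eq_xy; apply/adj_from_inj/mono_f.
by rewrite -!adj_from_natr eq_xy.
Qed.

Lemma counit_iso (Y : D) : fully_faithful R ->
  exists c : Y ~> L (R Y), counit Y ∘ c = idm Y /\ c ∘ counit Y = idm (L (R Y)).
Proof.
(* The inverse [c] is the preimage under [R] of the unit at [R Y]. *)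
move=> [fullR faithR]; have [c Rc] := fullR _ _ (adj_to adj (idm (L (R Y)))).
exists c; split.
  by apply: faithR; rewrite fmap_comp Rc -adj_natr comp_idr adj_fromK fmap_id.
by apply: adj_to_inj; rewrite adj_natr adj_fromK comp_idr.
Qed.

Hypothesis monoL : forall (X Y : C) (f : X ~> Y), mono f -> mono (fmap L f).
Hypothesis ffR : fully_faithful R.

Lemma counit_mono (Y : D) : mono (counit Y).
Proof. by have [c [_ cK]] := counit_iso Y ffR; apply: section_mono; exists c. Qed.

Lemma counit_section (Y : D) : is_section (counit Y).
Proof. by have [c [_ cK]] := counit_iso Y ffR; exists c. Qed.

(** The transpose of [f] is [fmap R f] after the unit at [R X], which is split by
    [fmap R (counit X)] (triangle identity). *)
Lemma adj_to_mono (X : D) (Y : D) (f : L (R X) ~> Y) :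
  mono f -> mono (adj_to adj f).
Proof.
move=> mono_f; rewrite -[f]comp_idr adj_natr.
apply: mono_comp; first exact: right_adjoint_mono.
have [c [_ cK]] := counit_iso X ffR.
apply: (@mono_of_comp _ _ _ _ (fmap R (counit X))).
rewrite -adj_natr comp_idr adj_fromK => T x y.
by rewrite !comp_idl.
Qed.

Lemma mono_of_adj_to (X : C) (Y : D) (f : L X ~> Y) :
  mono (adj_to adj f) -> mono f.
Proof.
move=> mono_f; rewrite -(adj_toK adj f) adj_fromE.
by apply: mono_comp; [exact: counit_mono | exact: monoL].
Qed.

(** [L] is faithful on morphisms into [R X], because [adj_from] is injective and factors through
    [fmap L]. *)
Lemma mono_of_left_adjoint_mono (X : D) (Y : C) (h : R X ~> Y) :
  mono (fmap L h) -> mono h.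
Proof.
move=> mono_Lh T x y eq_xy; apply: adj_from_inj; rewrite !adj_fromE.
by congr (_ ∘ _); apply: mono_Lh; rewrite -!fmap_comp eq_xy.
Qed.

Lemma right_adjoint_essential_mono (X Y : D) (e : X ~> Y) :
  essential_mono e -> essential_mono (fmap R e).
Proof.
move=> [mono_e ess_e]; split; first exact: right_adjoint_mono.
move=> P h mono_hRe; apply: mono_of_left_adjoint_mono.
have [c [cK Kc]] := counit_iso Y ffR; have [d [dK Kd]] := counit_iso X ffR.
(* Splitting off the counit leaves [fmap L h ∘ c], which starts at [Y], so essentiality of [e]
   applies to it. *)
rewrite -[fmap L h]comp_idr -Kc comp_assoc.
apply: mono_comp; last exact: counit_mono.
apply: ess_e.
have -> : fmap L h ∘ c ∘ e = fmap L (h ∘ fmap R e) ∘ d.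
  (* Naturality of the counit identifies [e] with [fmap L (fmap R e)] up to isomorphism. *)
  have eE : e = counit Y ∘ fmap L (fmap R e) ∘ d.
    by rewrite counit_natural -comp_assoc dK comp_idr.
  rewrite fmap_comp {1}eE !comp_assoc -[fmap L h ∘ c ∘ _]comp_assoc Kc.
  by rewrite comp_idr.
by apply: mono_comp; [exact: monoL | apply: section_mono; exists (counit X)].
Qed.

(** Transposing turns [h ∘ fmap L e] into [adj_to adj h ∘ e], where essentiality of [e] applies;
    being mono passes through the transposition both ways. *)
Lemma left_adjoint_essential_mono (X : D) (Y : C) (e : R X ~> Y) :
  essential_mono e -> essential_mono (fmap L e).
Proof.
move=> [mono_e ess_e]; split; first exact: monoL.
move=> P h mono_hLe; apply/mono_of_adj_to/ess_e.
by rewrite -adj_natl; apply: adj_to_mono.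
Qed.

End Adjunction.

(** * Kernels under a right adjoint, and part (1) *)

Section AbelianAdjunction.
Variables (A B : abelian) (L : functor A B) (R : functor B A).
Variable adj : adjunction L R.

(** Functors are not assumed additive. A zero map factors through a zero object [Z], and maps into
    [R Z] are unique since their transposes end in [Z]. *)
Lemma right_adjoint_zerom (X Y : B) : fmap R (zerom X Y) = zerom (R X) (R Y).
Proof.
have [Z zeroZ] := has_zero B.
have ->: zerom X Y = zerom Z Y ∘ zerom X Z by rewrite comp0m.
suff R0 : fmap R (zerom X Z) = zerom (R X) (R Z) by rewrite fmap_comp R0 compm0.
apply: (adj_from_inj (adj := adj)).
have [_ [p [_ p_unique]]] := zeroZ (L (R X)).
by rewrite -[LHS]p_unique // -[RHS]p_unique.
Qed.

Lemma adj_from_zerom (X : A) (Y : B) : adj_from adj (zerom X (R Y)) = zerom (L X) Y.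
Proof.
apply: (adj_to_inj (adj := adj)); rewrite adj_fromK.
have ->: zerom (L X) Y = zerom (L X) Y ∘ idm (L X) by rewrite comp_idr.
by rewrite adj_natr right_adjoint_zerom comp0m.
Qed.

Lemma right_adjoint_kernel (X Y K : B) (f : X ~> Y) (k : K ~> X) :
  is_kernel f k -> is_kernel (fmap R f) (fmap R k).
Proof.
move=> ker_k; have [fk0 ker_univ] := ker_k; split.
  by rewrite -fmap_comp fk0 right_adjoint_zerom.
move=> T x Rfx0; have [|u [ku _]] := ker_univ (L T) (adj_from adj x).
  by rewrite -adj_from_natr Rfx0 adj_from_zerom.
have Rku : fmap R k ∘ adj_to adj u = x by rewrite -adj_natr ku adj_fromK.
exists (adj_to adj u); split=> // v Rkv.
by apply: (right_adjoint_mono adj (kernel_mono ker_k)); rewrite Rku Rkv.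
Qed.

Lemma cs_rickart_right_adjoint (M N : B) :
  exact_functor L -> fully_faithful R -> cs_rickart M N <-> cs_rickart (R M) (R N).
Proof.
move=> exL ffR.
have monoL (X Y : A) (f : X ~> Y) : mono f -> mono (fmap L f).
  exact: exact_functor_mono.
split=> cs.
  (* By fullness every [g] comes from some [f]; its kernel is factored in [B], mapped by [R], and
     compared with [k]. *)
  move=> g K k ker_k; have [f Rf] := proj1 ffR _ _ g; subst g.
  have [K0 [k0 ker_k0]] := has_kernels f.
  have [P [e [s [ess_e [sec_s k0E]]]]] := cs f K0 k0 ker_k0.
  have [u [v [vu [uv ku]]]] := kernel_unique (right_adjoint_kernel ker_k0) ker_k.
  exists (R P), (fmap R e ∘ u), (fmap R s); split.
    apply: essential_mono_precomp_iso vu uv _.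
    exact: (right_adjoint_essential_mono adj).
  by split; [exact: fmap_section | rewrite -ku k0E fmap_comp comp_assoc].
move=> f K k ker_k.
have [P [e [s [ess_e [sec_s RkE]]]]] := cs _ _ _ (right_adjoint_kernel ker_k).
have [d [dK Kd]] := counit_iso adj K ffR.
(* The factorisation of [fmap R k] is sent back by [L] and corrected at both ends by the counit:
   [k = counit adj M ∘ fmap L (fmap R k) ∘ d]. *)
exists (L P), (fmap L e ∘ d), (counit adj M ∘ fmap L s); split.
  apply: essential_mono_precomp_iso dK Kd _.
  exact: (left_adjoint_essential_mono adj).
split; first by apply: section_comp; [exact: counit_section | exact: fmap_section].
rewrite -comp_assoc [fmap L s ∘ _]comp_assoc -fmap_comp -RkE.
by rewrite comp_assoc counit_natural -comp_assoc dK comp_idr.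
Qed.

End AbelianAdjunction.

(** * Opposite categories and part (2) *)

Definition op_category (C : category) : category :=
  @Category C (fun X Y => Y ~> X) (fun X => idm X) (fun X Y Z g f => f ∘ g)
    (fun X Y f => comp_idr f) (fun X Y f => comp_idl f)
    (fun X Y Z W h g f => eq_sym (comp_assoc f g h)).

Definition op_preadditive (C : preadditive) : preadditive :=
  @Preadditive (op_category C) (fun X Y => zerom Y X)
    (fun X Y f => oppm f) (fun X Y f g => addm f g)
    (fun X Y => @addmA C Y X) (fun X Y => @addmC C Y X)
    (fun X Y => @add0m C Y X) (fun X Y => @addNm C Y X)
    (fun X Y Z g h f => comp_addr f g h) (fun X Y Z f g h => comp_addl g h f).

Lemma op_has_zero (C : abelian) : exists Z : op_preadditive C, zero_object Z.
Proof. by have [Z zeroZ] := has_zero C; exists Z => X; have [] := zeroZ X. Qed.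

Lemma op_has_biproducts (C : abelian) (X Y : op_preadditive C) :
  exists (S : op_preadditive C) (i1 : X ~> S) (i2 : Y ~> S) (p1 : S ~> X) (p2 : S ~> Y),
    is_biproduct i1 i2 p1 p2.
Proof.
have [S [i1 [i2 [p1 [p2 [? [? [? [? ?]]]]]]]]] := @has_biproducts C X Y.
by exists S, p1, p2, i1, i2.
Qed.

Definition op_abelian (C : abelian) : abelian :=
  @Abelian (op_preadditive C) (op_has_zero C) (@op_has_biproducts C)
    (fun X Y => @has_cokernels C Y X) (fun X Y => @has_kernels C Y X)
    (fun X Y => @epi_normal C Y X) (fun X Y => @mono_normal C Y X).

Definition op_functor (C D : category) (F : functor C D) :
    functor (op_category C) (op_category D) :=
  @Functor (op_category C) (op_category D) F (fun X Y f => fmap F f)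
    (fun X => fmap_id F X) (fun X Y Z g f => fmap_comp F f g).

Lemma op_exact_functor (C D : abelian) (F : functor C D) :
  exact_functor F -> @exact_functor (op_abelian C) (op_abelian D) (op_functor F).
Proof.
move=> exF X Y Z f g [ker coker].
by have [] := exF _ _ _ _ _ (conj coker ker); split.
Qed.

Lemma op_fully_faithful (C D : category) (F : functor C D) :
  fully_faithful F -> fully_faithful (op_functor F).
Proof. by move=> [fullF faithF]; split=> X Y; [exact: fullF | exact: faithF]. Qed.

Definition op_adjunction (C D : category) (L : functor C D) (R : functor D C)
    (adj : adjunction L R) : adjunction (op_functor R) (op_functor L) :=
  @Adjunction (op_category D) (op_category C) (op_functor R) (op_functor L)
    (fun X Y f => adj_from adj f) (fun X Y g => adj_to adj g)
    (fun X Y f => adj_fromK adj f) (fun X Y g => adj_toK adj g)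
    (fun X X' Y f x => adj_from_natr adj f x)
    (fun X Y Y' f y => adj_from_natl adj f y).

(** Each notion is convertible to its dual in the opposite category, so only the witnesses need
    reordering. *)
Lemma dual_cs_rickart_op (C : abelian) (M N : C) :
  dual_cs_rickart M N <-> @cs_rickart (op_abelian C) N M.
Proof.
split=> cs f Q q coker_q; have [P] := cs f Q q coker_q.
  by move=> [r [t [? [? ?]]]]; exists P, t, r.
by move=> [t [r [? [? ?]]]]; exists P, r, t.
Qed.

Theorem theorem3p3 (A B : abelian) (L : functor A B) (R : functor B A)
    (adj : adjunction L R) :
  (exact_functor L -> fully_faithful R ->
    forall M N : B, cs_rickart M N <-> cs_rickart (R M) (R N)) /\
  (exact_functor R -> fully_faithful L ->
    forall M N : A, dual_cs_rickart M N <-> dual_cs_rickart (L M) (L N)).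
Proof.
split=> [exL ffR M N | exR ffL M N]; first exact: (cs_rickart_right_adjoint adj).
(* [op_functor L] is now the right adjoint. The objects are swapped because a map from [M] to [N] is
   one from [N] to [M] in the opposite category. *)
have main := @cs_rickart_right_adjoint (op_abelian B) (op_abelian A)
  (op_functor R) (op_functor L) (op_adjunction adj) N M
  (op_exact_functor exR) (op_fully_faithful ffL).
by split=> /dual_cs_rickart_op /main /dual_cs_rickart_op.
Qed.
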